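(* Let $F:\mathcal P(\mathbb R^d)\to\mathbb R$ be in $\mathcal C^1$ and assume its second order linear functional derivative $\frac{\delta^2F}{\delta m^2}:\mathcal P(\mathbb R^d)\times\mathbb R^d\times\mathbb R^d\to\mathbb R$ exists and is jointly continuous, and that there is $L>0$ such that for any random variables $\eta_1,\eta_2$ with $\mathbb E|\eta_i|^2<\infty$, $i=1,2$, $$\mathbb E\Big[\sup_{\nu\in\mathcal P_2(\mathbb R^d)}\Big|\frac{\delta F}{\delta m}(\nu,\eta_1)\Big|\Big]+\mathbb E\Big[\sup_{\nu\in\mathcal P_2(\mathbb R^d)}\Big|\frac{\delta^2F}{\delta m^2}(\nu,\eta_1,\eta_2)\Big|\Big]\le L.$$ If there is $m^*\in\mathcal P_2(\mathbb R^d)$ with $F(m^* )=\inf_{m\in\mathcal P_2(\mathbb R^d)}F(m)$, then for every $N\in\mathbb N$ $$\Big|\inf_{(x_i)_{i=1}^N\subset\mathbb R^d}F\Big(\frac1N\sum_{i=1}^N\delta_{x_i}\Big)-F(m^* )\Big|\le\frac{2L}{N}.$$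
   Context: $\mathcal P(\mathbb R^d)$ is the set of Borel probability measures on $\mathbb R^d$, $\mathcal P_2(\mathbb R^d)$ those with finite second moment. A function $F:\mathcal P(\mathbb R^d)\to\mathbb R$ is in $\mathcal C^1$ if there is a bounded continuous function $\frac{\delta F}{\delta m}:\mathcal P(\mathbb R^d)\times\mathbb R^d\to\mathbb R$ (the linear functional derivative, normalised by $\int\frac{\delta F}{\delta m}(m,x)m(dx)=0$) such that for all $m,m'$: $F(m')-F(m)=\int_0^1\int_{\mathbb R^d}\frac{\delta F}{\delta m}((1-\lambda)m+\lambda m',x)(m'-m)(dx)\,d\lambda$. The second order linear functional derivative $\frac{\delta^2F}{\delta m^2}(m,x,y)$ is the linear functional derivative (in the same sense, in the variable $y$) of the map $m\mapsto\frac{\delta F}{\delta m}(m,x)$ for fixed $x$. *)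

(* Defs.v *)
From HB Require Import structures.
From mathcomp Require Import all_boot all_order all_algebra.
From mathcomp Require Import all_classical all_reals all_analysis.
Set Implicit Arguments. Unset Strict Implicit. Unset Printing Implicit Defensive.
Import Order.TTheory GRing.Theory Num.Theory.
Import numFieldNormedType.Exports.
Local Open Scope classical_set_scope.
Local Open Scope ring_scope.

Section Defs.
Variables (R : realType) (d : nat).

(* R^d as a topological space: row vectors with the product (= Euclidean) topology *)
Notation V := 'rV[R]_d.

Definition Rd : measurableType _ := g_sigma_algebraType (@open V).

Definition sqnorm (x : V) : R := \sum_(i < d) (x ord0 i) ^+ 2.

Definition isProb (mu : set Rd -> \bar R) : Prop :=
  exists P : probability Rd R, forall A, P A = mu A.

Definition isP2 (mu : set Rd -> \bar R) : Prop :=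
  isProb mu /\ (\int[mu]_x (sqnorm x)%:E < +oo)%E.

Definition Rint (mu : set Rd -> \bar R) (f : V -> R) : R :=
  fine (\int[mu]_x (f x)%:E)%E.

Definition weak_cvg (mun : nat -> set Rd -> \bar R) (mu : set Rd -> \bar R) : Prop :=
  forall f : V -> R, continuous f -> (exists M : R, forall x, `|f x| <= M) ->
    (fun n => Rint (mun n) f) @ \oo --> Rint mu f.

Definition mix (l : R) (m m' : set Rd -> \bar R) : set Rd -> \bar R :=
  fun A => ((1 - l)%:E * m A + l%:E * m' A)%E.

Definition empirical (N : nat) (x : 'I_N -> V) : set Rd -> \bar R :=
  fun A => ((N%:R^-1)%:E * \sum_(i < N) (@dirac _ Rd (x i) R A))%E.

Definition bounded_on_P (G : (set Rd -> \bar R) -> V -> R) : Prop :=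
  exists M : R, forall m, isProb m -> forall x, `|G m x| <= M.

Definition cont_on_P (G : (set Rd -> \bar R) -> V -> R) : Prop :=
  forall (mn : nat -> set Rd -> \bar R) (m : set Rd -> \bar R)
         (xn : nat -> V) (x : V),
    (forall n, isProb (mn n)) -> isProb m -> weak_cvg mn m ->
    xn @ \oo --> x -> (fun n => G (mn n) (xn n)) @ \oo --> G m x.

Definition I01 : set R := `[0, 1].

Definition is_lfd (Phi : (set Rd -> \bar R) -> R)
    (G : (set Rd -> \bar R) -> V -> R) : Prop :=
  [/\ bounded_on_P G, cont_on_P G,
      (forall m, isProb m -> Rint m (G m) = 0) &
      (forall m m', isProb m -> isProb m' ->
        Phi m' - Phi m =
        fine (\int[lebesgue_measure]_(l in I01)
                (Rint m' (G (mix l m m')) - Rint m (G (mix l m m')))%R%:E)%E)].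

Definition cont2_on_P (H : (set Rd -> \bar R) -> V -> V -> R) : Prop :=
  forall (mn : nat -> set Rd -> \bar R) (m : set Rd -> \bar R)
         (xn yn : nat -> V) (x y : V),
    (forall n, isProb (mn n)) -> isProb m -> weak_cvg mn m ->
    xn @ \oo --> x -> yn @ \oo --> y ->
    (fun n => H (mn n) (xn n) (yn n)) @ \oo --> H m x y.

End Defs.

(* Main.v *)
(** For constant random variables the moment assumption says that [H] is bounded
    pointwise by [L] on [isP2].  The atoms can then be chosen greedily instead of
    at random: starting from [mstar], move mass [1/N] at a time from [mstar] to an
    atom [x].  If [m] is the current measure, choose [x] so that [G m x] is at
    most the [mstar]-mean of [G m]; the first order change of [F] is then
    nonpositive, and the second order change is at most [2 L / N^2] by the bound
    on [H].  After [N] moves nothing of [mstar] is left and [F] has increased by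
    at most [2 L / N]. *)
Require Import Defs.
From HB Require Import structures.
From mathcomp Require Import all_boot all_order all_algebra.
From mathcomp Require Import all_classical all_reals all_analysis.
From mathcomp Require Import measurable_realfun.
From mathcomp Require Import ring lra.
Set Implicit Arguments. Unset Strict Implicit. Unset Printing Implicit Defensive.
Import Order.TTheory GRing.Theory Num.Theory.
Import numFieldNormedType.Exports.
Local Open Scope classical_set_scope.
Local Open Scope ring_scope.

(* Monotonicity needs no measurability because the integral of a nonnegative function is a supremum over simple functions below it. *)
Lemma le_integral_nonmeasurable d (T : measurableType d) (R : realType)
    (mu : set T -> \bar R) (D : set T) (f g : T -> \bar R) :
  (forall x, D x -> f x <= g x)%E ->
  (\int[mu]_(x in D) f x <= \int[mu]_(x in D) g x)%E.
Proof.
move=> fg.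
have fgD x : ((f \_ D) x <= (g \_ D) x)%E.
  by rewrite /patch; case: ifPn => // /set_mem/fg.
rewrite /integral; apply: leeB; apply: ereal_sup_le => _ [h /= hle <-];
  exists h => //= x; apply: le_trans (hle x) _.
- by rewrite !funeposE ge_max !le_max fgD lexx orbT.
- by rewrite !funenegE ge_max !le_max leeN2 fgD lexx orbT.
Qed.

(** * Probability measures and bounded continuous functions *)

Section FiniteMeasures.
Variables (R : realType) (d : nat).
Local Notation V := 'rV[R]_d.
Local Notation T := (Rd R d).
Local Notation Rint := Defs.Rint.

(** [isProb] asks for a packaged probability. Normalising a measure of mass one gives it back
    unchanged; the Dirac mass is the default of [mnormalize] for total mass zero or infinity, which
    does not occur here. *)
Lemma isProb_measure (mu : {measure set T -> \bar R}) :
  mu setT = 1%E -> isProb mu.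
Proof.
move=> mu1; pose P : probability T R := mnormalize mu (@dirac _ T (0 : V) R).
exists P => A; rewrite -[LHS]/(mnormalize mu _ A) /mnormalize mu1 onee_eq0 /=.
by rewrite invr1 mule1.
Qed.

Lemma continuous_measurable_Rd (f : V -> R) :
  continuous f -> measurable_fun setT (f : T -> R).
Proof.
move=> /continuousP cf; apply: (measurability _ (RGenOpens.measurableE R)).
move=> _ [_ [a [b ->] <-]]; rewrite setTI; apply: sub_sigma_algebra.
exact/cf/interval_open.
Qed.

Definition bcont (f : V -> R) :=
  continuous f /\ exists M : R, forall x, `|f x| <= M.

Lemma bcont_integrable (mu : {measure set T -> \bar R}) (f : V -> R) :
  (mu setT < +oo)%E -> bcont f ->
  mu.-integrable setT (EFin \o (f : T -> R)).
Proof.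
move=> muT [cf [M fM]].
apply: measurable_bounded_integrable => //; first exact: continuous_measurable_Rd.
by exists M; split; [exact: num_real|move=> y My x _; exact: le_trans (fM x) (ltW My)].
Qed.

(** [cont_on_P] speaks of sequences only. At a point of discontinuity, picking a bad point in each
    ball of radius [1 / (n + 1)] gives a convergent sequence that contradicts the hypothesis. *)
Lemma sequentially_continuous (f : V -> R) :
  (forall (u : nat -> V) x, u @ \oo --> x -> f \o u @ \oo --> f x) ->
  continuous f.
Proof.
move=> sf x; apply: contrapT => ncf.
have [e e0 He] : exists2 e : R, 0 < e &
    forall n : nat, exists y, ball x (n.+1%:R^-1) y /\ e <= `|f x - f y|.
  apply: contrapT => /forall2NP ne; apply: ncf.
  apply/(@cvgrPdist_lt _ _ _ (nbhs x) (nbhs_filter x)) => e e0.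
  have [//|/existsNP[n /forallNP nH]] := ne e.
  apply/nbhs_ballP; exists n.+1%:R^-1 => /=; first by rewrite invr_gt0 ltr0Sn.
  by move=> y xy; rewrite ltNge; apply/negP => ey; apply: (nH y).
have /choice[u uP] := He.
have ux : u @ \oo --> x.
  apply/cvg_ballP => r r0.
  have := @cvg_harmonic R => /cvgrPdist_lt /(_ _ r0) [N _ HN].
  exists N => // n /= /HN; rewrite /harmonic /= sub0r normrN ger0_norm ?invr_ge0 //.
  by move=> /ltW nr; apply: le_ball nr _ _; case: (uP n).
have /cvgrPdist_lt/(_ _ e0)[N _ /(_ N (leqnn N))/=] := sf u x ux.
by case: (uP N) => _; rewrite leNgt => /negP.
Qed.

Lemma cont_on_P_bcont (G : (set T -> \bar R) -> V -> R) (m : set T -> \bar R) :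
  bounded_on_P G -> cont_on_P G -> isProb m -> bcont (G m).
Proof.
move=> [M GM] cG Pm; split; last by exists M; exact: GM.
apply: sequentially_continuous => u x ux.
(* A constant sequence of measures converges weakly, so joint continuity gives continuity in the
   point alone. *)
by apply: (cG (fun=> m) m) => // f _ _; exact: cvg_cst.
Qed.

(** * Nonnegative combinations of finite measures *)

Definition comb (a : R) (m : set T -> \bar R) (b : R) (m' : set T -> \bar R) :
  set T -> \bar R := fun A => (a%:E * m A + b%:E * m' A)%E.

(* The equality holds on all sets, measurable or not, since [F], [G] and [H] take arbitrary set functions. *)
Definition has_mass (m : set T -> \bar R) (t : R) :=
  exists2 mu : {measure set T -> \bar R}, m = mu & mu setT = t%:E.

Lemma isProb_has_mass m : isProb m <-> has_mass m 1.
Proof.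
split=> [[P Pm]|[mu -> mu1]]; last exact: isProb_measure.
by exists P; [apply/funext => A; exact/esym/Pm|exact: probability_setT].
Qed.

Lemma comb_measure (mu mu' : {measure set T -> \bar R}) (a b : {nonneg R}) :
  comb a%:num mu b%:num mu' = measure_add (mscale a mu) (mscale b mu').
Proof. by apply/funext => A; rewrite measure_addE. Qed.

Lemma has_mass_comb a b m m' t t' : 0 <= a -> 0 <= b ->
  has_mass m t -> has_mass m' t' ->
  has_mass (comb a m b m') (a * t + b * t').
Proof.
move=> a0 b0 [mu -> mut] [mu' -> mu't'].
exists (measure_add (mscale (NngNum a0) mu) (mscale (NngNum b0) mu')).
  exact: (comb_measure mu mu' (NngNum a0) (NngNum b0)).
transitivity (a%:E * mu setT + b%:E * mu' setT)%E; first exact: measure_addE.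
by rewrite mut mu't'.
Qed.

Lemma integral_comb_ge0 a b m m' t t' (f : V -> R) : 0 <= a -> 0 <= b ->
  has_mass m t -> has_mass m' t' ->
  measurable_fun setT (f : T -> R) -> (forall x, 0 <= f x) ->
  (\int[comb a m b m']_x (f x)%:E =
   a%:E * \int[m]_x (f x)%:E + b%:E * \int[m']_x (f x)%:E)%E.
Proof.
move=> a0 b0 [mu -> _] [mu' -> _] mf f0.
have mEf : measurable_fun setT ((fun x => (f x)%:E) : T -> \bar R) by exact/measurable_EFinP.
rewrite (comb_measure mu mu' (NngNum a0) (NngNum b0)).
rewrite ge0_integral_measure_add//; last by move=> x _; rewrite lee_fin.
by rewrite !ge0_integral_mscale// => x _; rewrite lee_fin.
Qed.

Lemma Rint_cst m t c : has_mass m t -> Rint m (cst c) = c * t.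
Proof. by move=> [mu -> mut]; rewrite [LHS]Rintegral_cst//= mut. Qed.

Lemma Rint_B m t f g : has_mass m t -> bcont f -> bcont g ->
  Rint m (fun x => f x - g x) = Rint m f - Rint m g.
Proof.
move=> [mu -> mut] bf bg.
by rewrite [LHS]RintegralB//; apply: bcont_integrable => //; rewrite mut ltry.
Qed.

Lemma le_Rint m t f g : has_mass m t -> bcont f -> bcont g ->
  (forall x, f x <= g x) -> Rint m f <= Rint m g.
Proof.
move=> [mu -> mut] bf bg fg.
by apply: le_Rintegral => //; apply: bcont_integrable => //; rewrite mut ltry.
Qed.

Lemma bcont_cst c : bcont (cst c).
Proof. by split; [exact: cst_continuous|exists `|c|]. Qed.

Lemma bcontB f g : bcont f -> bcont g -> bcont (fun x => f x - g x).
Proof.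
move=> [cf [M fM]] [cg [N gN]]; split.
  by move=> x; exact: (cvgB (cf x) (cg x)).
by exists (M + N) => x; rewrite (le_trans (ler_normB _ _))// lerD.
Qed.

Lemma Rint_comb a b m m' t t' f : 0 <= a -> 0 <= b ->
  has_mass m t -> has_mass m' t' -> bcont f ->
  Rint (comb a m b m') f = a * Rint m f + b * Rint m' f.
Proof.
move=> a0 b0 mt m't' bf; have [cf [M fM]] := bf.
have ge0_case g : bcont g -> (forall x, 0 <= g x) ->
    Rint (comb a m b m') g = a * Rint m g + b * Rint m' g.
  move=> bg g0; rewrite /Rint (integral_comb_ge0 a0 b0 mt m't')//; last first.
    by apply: continuous_measurable_Rd; case: bg.
  case: mt m't' => mu -> mut [mu' -> mu't'].
  have fing (nu : {measure set T -> \bar R}) s : nu setT = s%:E ->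
      (\int[nu]_x (g x)%:E)%E \is a fin_num.
    move=> nus; apply: integrable_fin_num => //.
    by apply: bcont_integrable => //; rewrite nus ltry.
  rewrite fineD ?fin_numM ?(fing _ _ mut) ?(fing _ _ mu't')//.
  by rewrite !fineM ?(fing _ _ mut) ?(fing _ _ mu't').
(* Additivity in the measure is known so far for nonnegative integrands. It is applied to [f + M];
   the constant contributes [M * (a * t + b * t')] on both sides and cancels. *)
have bM := bcont_cst (- M).
have mtE := Rint_cst (- M) mt; have m'tE := Rint_cst (- M) m't'.
have cE := Rint_cst (- M) (has_mass_comb a0 b0 mt m't').
have := ge0_case _ (bcontB bf bM).
rewrite (Rint_B mt)// (Rint_B m't')// (Rint_B (has_mass_comb a0 b0 mt m't'))//.
rewrite mtE m'tE cE => h; have {}h := h _; have : Rint (comb a m b m') f -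
  - M * (a * t + b * t') = a * (Rint m f - - M * t) + b * (Rint m' f - - M * t').
  by apply: h => x; have := fM x; rewrite ler_norml /= => /andP[+ _]; lra.
by move=> e; lra.
Qed.

(** * Finite second moments *)

Definition finite_moment2 (m : set T -> \bar R) :=
  (\int[m]_x (sqnorm x)%:E < +oo)%E.

Lemma sqnorm_ge0 (x : V) : 0 <= sqnorm x.
Proof. by apply: sumr_ge0 => i _; exact: sqr_ge0. Qed.

Lemma sqnorm_continuous : continuous (@sqnorm R d).
Proof.
rewrite /sqnorm; apply: continuous_big => [|i _ x]; first exact: add_continuous.
have c : (fun y : V => y ord0 i) @ x --> x ord0 i by exact: coord_continuous.
exact: (cvgM c c).
Qed.

Lemma isP2_has_mass m : isP2 m <-> has_mass m 1 /\ finite_moment2 m.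
Proof. by rewrite /isP2 isProb_has_mass. Qed.

Lemma isP2_isProb (m : set T -> \bar R) : isP2 m -> isProb m.
Proof. by case. Qed.

Lemma finite_moment2_comb a b m m' t t' : 0 <= a -> 0 <= b ->
  has_mass m t -> has_mass m' t' -> finite_moment2 m -> finite_moment2 m' ->
  finite_moment2 (comb a m b m').
Proof.
move=> a0 b0 mt m't' fm fm'; rewrite /finite_moment2.
rewrite (integral_comb_ge0 a0 b0 mt m't').
- by apply: lte_add_pinfty; apply: lte_mul_pinfty; rewrite ?lee_fin.
- exact: continuous_measurable_Rd sqnorm_continuous.
- exact: sqnorm_ge0.
Qed.

Lemma isP2_mix l (m m' : set T -> \bar R) : 0 <= l <= 1 -> isP2 m -> isP2 m' -> isP2 (mix l m m').
Proof.
move=> /andP[l0]; rewrite -subr_ge0 => l1.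
move=> /isP2_has_mass[m1 fm] /isP2_has_mass[m'1 fm'].
apply/isP2_has_mass; split; last exact: (finite_moment2_comb l1 l0 m1 m'1).
rewrite -[X in has_mass _ X](_ : (1 - l) * 1 + l * 1 = 1); last by ring.
exact: (has_mass_comb l1 l0 m1 m'1).
Qed.

(** * Dirac masses and points below the mean *)

Lemma has_mass_dirac (x : V) : has_mass (@dirac _ T x R) 1.
Proof. by exists (@dirac _ T x R) => //; rewrite [LHS]diracT. Qed.

Lemma integral_dirac_continuous (x : V) (f : V -> R) : continuous f ->
  (\int[@dirac _ T x R]_y (f y)%:E = (f x)%:E)%E.
Proof.
move=> cf; rewrite integral_dirac ?diracT ?mul1e//.
apply/measurable_EFinP; exact: continuous_measurable_Rd.
Qed.

Lemma finite_moment2_dirac (x : V) : finite_moment2 (@dirac _ T x R).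
Proof.
by rewrite /finite_moment2 integral_dirac_continuous ?ltry//; exact: sqnorm_continuous.
Qed.

Lemma Rint_dirac (x : V) f : bcont f -> Rint (@dirac _ T x R) f = f x.
Proof. by move=> [cf _]; rewrite /Rint integral_dirac_continuous. Qed.

(** Otherwise [f] minus its mean is positive everywhere with integral zero, hence zero almost
    everywhere. The exceptional null set is then the whole space, which has mass one. *)
Lemma exists_le_mean m f : has_mass m 1 -> bcont f -> exists x, f x <= Rint m f.
Proof.
move=> m1 bf; apply: contrapT => /forallNP nle.
set c := Rint m f in nle.
have bg := bcontB bf (bcont_cst c).
have g0 x : 0 < f x - cst c x by rewrite subr_gt0 ltNge; apply/negP/nle.
have : Rint m (fun x => f x - cst c x) = 0.
  by rewrite (Rint_B m1)// ?(Rint_cst _ m1) ?mulr1 ?subrr//; exact: bcont_cst.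
case: m1 => mu -> mu1 Rg0.
have ig : mu.-integrable setT (EFin \o ((fun x => f x - cst c x) : T -> R)).
  by apply: bcont_integrable => //; rewrite mu1 ltry.
have : (\int[mu]_x `|(f x - cst c x)%:E| = 0)%E.
  rewrite -[RHS](congr1 EFin Rg0) /Rint fineK; last exact: integrable_fin_num ig.
  by apply: eq_integral => x _; rewrite gee0_abs// lee_fin ltW.
move=> /(ae_eq_integral_abs _ measurableT (measurable_int _ ig))[N [mN N0 sN]].
have NT : N = setT.
  apply/seteqP; split=> // x _; apply: sN => /= /(_ I) [] /eqP.
  by rewrite gt_eqF.
by move: mu1; rewrite -NT N0 => /eqP; rewrite eqe eq_sym oner_eq0.
Qed.

(** * Increments along a segment of measures *)

Lemma integral_affine01 (a b : R) :
  (\int[lebesgue_measure]_(l in @I01 R) (a + b * l)%:E = (a + b / 2)%:E)%E.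
Proof.
rewrite /I01; have int f : continuous f ->
    lebesgue_measure.-integrable `[0, 1] (EFin \o (f : R -> R)).
  move=> cf; apply: continuous_compact_integrable; first exact: segment_compact.
  exact: continuous_subspaceT.
have cid : continuous (fun l : R => (unstable.onem l) ^+ 1).
  by move=> x; apply: cvgB; [exact: cvg_cst|exact: cvg_id].
have caff : continuous (fun l : R => a + b * l).
  move=> x; apply: cvgD; first exact: cvg_cst.
  by apply: cvgM; [exact: cvg_cst|exact: cvg_id].
rewrite -[LHS]fineK; last first.
  by apply: integrable_fin_num; [exact: measurable_itv|exact: int].
congr EFin; rewrite -[LHS]/(Rintegral _ _ _).
(* The known integral is that of [1 - l], so [a + b * l] is rewritten as [(a + b) - b * (1 - l)]. *)
have := @Rintegral_onemXn R 1; set J := Rintegral _ _ _ => JE.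
transitivity (\int[lebesgue_measure]_(l in `[0, 1]) ((a + b) - b * (unstable.onem l) ^+ 1)).
  by apply: eq_Rintegral => l _; rewrite /unstable.onem expr1; ring.
have cb : continuous (fun l : R => b * (unstable.onem l) ^+ 1).
  by move=> x; apply: cvgM; [exact: cvg_cst|exact: cid].
rewrite RintegralB//; [|by apply: int => x; exact: cvg_cst|exact: int].
rewrite RintegralZl//; last exact: int.
rewrite -/J JE Rintegral_cst//.
have I1 : lebesgue_measure (`[0, 1]%classic : set R) = 1%E.
  by rewrite lebesgue_measure_itv/= lte_fin ltr01/= sube0.
rewrite (congr1 fine (I1 : lebesgue_measure _ = _)) /=.
by field.
Qed.

(** Integrates the affine bound over [[0, 1]]. The lower bound [- K] is more than a by-product:
    [fine] sends infinite values to [0], so an upper bound on the integral passes to its [fine] only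
    once [-oo] is excluded. *)
Lemma lfd_increment Phi G (m m' : set T -> \bar R) (K a b : R) :
  is_lfd Phi G -> isProb m -> isProb m' ->
  (forall l, 0 <= l <= 1 ->
     - K <= Rint m' (G (mix l m m')) - Rint m (G (mix l m m')) <= a + b * l) ->
  - K <= Phi m' - Phi m <= a + b / 2.
Proof.
move=> [_ _ _ incr] Pm Pm' h; rewrite incr//.
set J := (X in fine X).
have lJ : ((- K)%:E <= J)%E.
  rewrite -[- K]addr0 -[X in - K + X](mul0r 2^-1) -integral_affine01.
  apply: le_integral_nonmeasurable => l /=; rewrite /I01/= in_itv/= lee_fin => /h.
  by rewrite mul0r addr0 => /andP[].
have Ju : (J <= (a + b / 2)%:E)%E.
  rewrite -integral_affine01; apply: le_integral_nonmeasurable => l /=.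
  by rewrite /I01/= in_itv/= lee_fin => /h /andP[].
by case: J lJ Ju => [r| |]//=; rewrite ?lee_fin => -> ->.
Qed.

(** * One transfer of mass [e] from [mstar] to an atom *)

Section Step.
Variables (F : (set T -> \bar R) -> R) (G : (set T -> \bar R) -> V -> R).
Variables (H : (set T -> \bar R) -> V -> V -> R) (L : R).
Hypothesis lfdG : is_lfd F G.
Hypothesis lfdH : forall x, is_lfd (fun m => G m x) (fun m => H m x).
Hypothesis H_le : forall nu, isP2 nu -> forall x y, `|H nu x y| <= L.

(* [m'] arises from [m] by moving mass [e] from [mstar] to the atom [x]. *)
Variables (B mstar : set T -> \bar R) (e : R) (x : V).
Hypotheses (e0 : 0 <= e) (B_mass : has_mass B (1 - e)).
Hypotheses (B_moment : finite_moment2 B) (P2star : isP2 mstar).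

Let m := comb 1 B e mstar.
Let m' := comb 1 B e (@dirac _ T x R).

Let massstar : has_mass mstar 1. Proof. by case/isP2_has_mass: P2star. Qed.

Let P2comb nu : has_mass nu 1 -> finite_moment2 nu -> isP2 (comb 1 B e nu).
Proof.
move=> nu1 fnu; apply/isP2_has_mass; split.
  rewrite -[X in has_mass _ X](_ : 1 * (1 - e) + e * 1 = 1); last by ring.
  exact: (has_mass_comb ler01 e0 B_mass nu1).
exact: (finite_moment2_comb ler01 e0 B_mass nu1).
Qed.

Lemma isP2_before : isP2 m.
Proof. by apply: P2comb => //; case/isP2_has_mass: P2star. Qed.

Lemma isP2_after : isP2 m'.
Proof. by apply: P2comb; [exact: has_mass_dirac|exact: finite_moment2_dirac]. Qed.

Lemma Rint_swap f : bcont f -> Rint m' f - Rint m f = e * (f x - Rint mstar f).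
Proof.
move=> bf; rewrite (Rint_comb ler01 e0 B_mass massstar bf).
rewrite (Rint_comb ler01 e0 B_mass (has_mass_dirac x) bf) Rint_dirac//; ring.
Qed.

Let G_bcont nu : isProb nu -> bcont (G nu).
Proof. by case: lfdG => bG cG _ _; exact: cont_on_P_bcont. Qed.

Let H_bcont nu y : isProb nu -> bcont (H nu y).
Proof. by have [bH cH _ _] := lfdH y; exact: (cont_on_P_bcont bH cH). Qed.

Lemma mean_le f c : bcont f -> (forall y, `|f y| <= c) -> `|Rint mstar f| <= c.
Proof.
move=> bf fc; rewrite ler_norml -[c]mulr1 -mulNr.
rewrite -!(Rint_cst _ massstar); apply/andP.
by split; apply: (le_Rint massstar) => //; try exact: bcont_cst;
  move=> y; have := fc y; rewrite ler_norml => /andP[].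
Qed.

(** Second order estimate: [mix l m m'] differs from [m] by [l * e] times the Dirac mass at [x]
    minus [mstar]. Against this difference [H] integrates to at most [l * e * (L + L)] in absolute
    value. *)
Lemma derivative_drift l y : 0 <= l <= 1 ->
  `|G (mix l m m') y - G m y| <= 2 * L * e * l.
Proof.
move=> l01; have /andP[l0 l1] := l01; have ml := isP2_mix l01 isP2_before isP2_after.
have := @lfd_increment _ _ m (mix l m m') (2 * L * e * l) (2 * L * e * l) 0 (lfdH y).
rewrite mul0r addr0 -ler_norml; apply.
- exact: isP2_isProb isP2_before.
- exact: isP2_isProb ml.
move=> k k01; rewrite mul0r addr0 -ler_norml.
(* [H_le] holds on [isP2] only, so the intermediate measure must have a finite second moment. *)
set nu := mix k m _; have nu2 : isP2 nu by apply: isP2_mix => //; exact: isP2_before.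
have bh := H_bcont y (isP2_isProb nu2).
(* [mix l m m'] unfolds to [comb (1 - l) m l m']. *)
rewrite (@Rint_comb (1 - l) l m m' 1 1)//; last 3 first.
- by rewrite subr_ge0.
- by case/isP2_has_mass: isP2_before.
- by case/isP2_has_mass: isP2_after.
have -> : (1 - l) * Rint m (H nu y) + l * Rint m' (H nu y) - Rint m (H nu y) =
    l * (Rint m' (H nu y) - Rint m (H nu y)) by ring.
rewrite Rint_swap// mulrA normrM ger0_norm ?mulr_ge0//.
rewrite [leRHS](_ : _ = l * e * (L + L)); last by ring.
rewrite ler_wpM2l ?mulr_ge0// (le_trans (ler_normB _ _))// lerD//.
  exact: H_le.
by apply: mean_le => // z; exact: H_le.
Qed.

(** At parameter [l] the integrand is [e] times the value of the derivative at [x] minus its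
    [mstar]-mean. This difference is nonpositive for [G m], and value and mean each drift by at most
    [2 * L * e * l]; integrating [4 * L * e ^+ 2 * l] gives the bound. *)
Lemma swap_increment : G m x <= Rint mstar (G m) -> F m' <= F m + 2 * L * e ^+ 2.
Proof.
move=> Gx; have [[M GM] cG _ _] := lfdG.
have P2m := isP2_before; have P2m' := isP2_after.
(* The lower bound [- (2 * M * e)] comes from the uniform bound [M] on [G] and serves only to keep
   the integral finite. *)
have := @lfd_increment _ _ m m' (2 * M * e) 0 (4 * L * e ^+ 2) lfdG
  (isP2_isProb P2m) (isP2_isProb P2m').
have -> : 0 + 4 * L * e ^+ 2 / 2 = 2 * L * e ^+ 2 by field.
rewrite lerBlDl => h; refine (proj2 (elimT andP (h _))) => l l01 {h}.
have Pl := isP2_isProb (isP2_mix l01 P2m P2m'); have bg := G_bcont Pl.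
have bg0 := G_bcont (isP2_isProb P2m).
rewrite Rint_swap//; set g := G (mix l m m') in bg *; apply/andP; split.
  rewrite lerNl -mulrN [leRHS](_ : _ = e * (M + M)); last by ring.
  rewrite ler_wpM2l// (le_trans (ler_norm _))// normrN (le_trans (ler_normB _ _))//.
  by rewrite lerD//; [exact: GM|apply: mean_le => // z; exact: GM].
have drift := derivative_drift _ l01.
have gx := drift x.
have gm : `|Rint mstar (fun y => g y - G m y)| <= 2 * L * e * l.
  exact: mean_le (bcontB bg bg0) drift.
rewrite (Rint_B massstar)// in gm.
have -> : 0 + 4 * L * e ^+ 2 * l = e * (2 * L * e * l + 2 * L * e * l) by ring.
rewrite ler_wpM2l//; move: gx gm Gx; rewrite -/g !ler_norml => /andP[_ h1] /andP[h2 _] h3.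
lra.
Qed.

End Step.

(** * Equally weighted sums of Dirac masses *)

Definition dirac_sum (c : R) (s : seq V) : set T -> \bar R :=
  fun A => (\sum_(y <- s) c%:E * @dirac _ T y R A)%E.

Lemma dirac_sum_cons c y s :
  dirac_sum c (y :: s) = comb c (@dirac _ T y R) 1 (dirac_sum c s).
Proof. by apply/funext => A; rewrite /dirac_sum /comb big_cons mul1e. Qed.

Lemma dirac_sum_mass c s : 0 <= c ->
  has_mass (dirac_sum c s) (c * (size s)%:R) /\ finite_moment2 (dirac_sum c s).
Proof.
move=> c0; elim: s => [|y s [IHm IHf]].
  have -> : dirac_sum c [::] = mzero :> (set T -> \bar R).
    by apply/funext => A; rewrite /dirac_sum big_nil.
  rewrite mulr0; split; first by exists mzero.
  by rewrite /finite_moment2 integral_measure_zero.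
have dy := has_mass_dirac y.
rewrite dirac_sum_cons; split; last first.
  by apply: (finite_moment2_comb c0 ler01 dy IHm) => //; exact: finite_moment2_dirac.
rewrite (_ : c * _ = c * 1 + 1 * (c * (size s)%:R)); first exact: has_mass_comb.
by rewrite /= -natr1; ring.
Qed.

(** Ties the weight to the number of atoms. In [dirac_sum] the two are independent, so that an
    unfinished list of atoms can carry mass below one. *)
Lemma empirical_dirac_sum N (t : N.-tuple V) :
  empirical (tnth t) = dirac_sum N%:R^-1 t.
Proof.
by apply/funext => A; rewrite /empirical /dirac_sum big_tuple ge0_sume_distrr.
Qed.

Lemma isP2_empirical N (x : 'I_N -> V) : (0 < N)%N -> isP2 (empirical x).
Proof.
move=> N0; have -> : x = tnth [tuple x i | i < N].
  by apply/funext => i; rewrite tnth_mktuple.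
rewrite empirical_dirac_sum; apply/isP2_has_mass.
have := @dirac_sum_mass N%:R^-1 [tuple x i | i < N].
rewrite size_tuple mulVf ?pnatr_eq0 -?lt0n//; apply.
by rewrite invr_ge0.
Qed.

(** * Greedy construction of the atoms *)

Section Greedy.
Variables (F : (set T -> \bar R) -> R) (G : (set T -> \bar R) -> V -> R).
Variables (H : (set T -> \bar R) -> V -> V -> R) (L : R).
Hypothesis lfdG : is_lfd F G.
Hypothesis lfdH : forall x, is_lfd (fun m => G m x) (fun m => H m x).
Hypothesis H_le : forall nu, isP2 nu -> forall x y, `|H nu x y| <= L.
Variables (mstar : set T -> \bar R) (e : R).
Hypotheses (P2star : isP2 mstar) (e0 : 0 <= e).

(** Induction on the number of moves, each costing at most [2 * L * e ^+ 2]; [e * k%:R <= 1] says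
    that [mstar] still has the mass to be moved. *)
Lemma greedy_atoms k : e * k%:R <= 1 -> exists2 s : seq V, size s = k &
  F (comb 1 (dirac_sum e s) (1 - e * k%:R) mstar)
    <= F mstar + k%:R * (2 * L * e ^+ 2).
Proof.
elim: k => [|k IHk] ek.
  exists [::] => //; rewrite !mulr0 mul0r subr0 addr0 (_ : comb _ _ _ _ = mstar)//.
  by apply/funext => A; rewrite /comb /dirac_sum big_nil mule0 add0e mul1e.
have [|s sk Fs] := IHk.
  by apply: le_trans ek; rewrite ler_wpM2l// ler_nat.
have rest0 : 0 <= 1 - e * k.+1%:R by rewrite subr_ge0.
have /isP2_has_mass[star1 fstar] := P2star.
have [sm fs] := dirac_sum_mass s e0.
(* [B] is the part untouched by this move: the atoms so far and what will remain of [mstar]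
   afterwards. The measure before the move is [B] plus mass [e] of [mstar]. *)
set B := comb 1 (dirac_sum e s) (1 - e * k.+1%:R) mstar.
have Bm : has_mass B (1 - e).
  rewrite (_ : 1 - e = 1 * (e * (size s)%:R) + (1 - e * k.+1%:R) * 1).
    exact: has_mass_comb.
  by rewrite sk -natr1; ring.
have fB : finite_moment2 B by exact: (finite_moment2_comb ler01 rest0 sm star1).
have before : comb 1 (dirac_sum e s) (1 - e * k%:R) mstar = comb 1 B e mstar.
  apply/funext => A; rewrite /B /comb !mul1e -addeA -ge0_muleDl ?lee_fin//.
  by congr (_ + _ * _)%E; rewrite -EFinD; congr EFin; rewrite -natr1; ring.
have P2B : isP2 (comb 1 B e mstar) by exact: isP2_before.
have [x Gx] : exists x, G (comb 1 B e mstar) x <= Rint mstar (G (comb 1 B e mstar)).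
  apply: exists_le_mean => //; case: lfdG => bG cG _ _.
  by apply: cont_on_P_bcont => //; exact: isP2_isProb.
exists (x :: s); first by rewrite /= sk.
have := swap_increment lfdG lfdH H_le e0 Bm fB P2star Gx.
have -> : comb 1 B e (@dirac _ T x R) =
    comb 1 (dirac_sum e (x :: s)) (1 - e * k.+1%:R) mstar.
  apply/funext => A; rewrite /B dirac_sum_cons /comb !mul1e.
  by rewrite addeC addeA.
move=> /le_trans; apply; rewrite -before -[k.+1%:R]natr1 [(k%:R + 1) * _]mulrDl mul1r addrA lerD2r.
exact: Fs.
Qed.

End Greedy.

End FiniteMeasures.

Theorem theorem2p2 (R : realType) (d : nat)
  (F : (set (Rd R d) -> \bar R) -> R)
  (G : (set (Rd R d) -> \bar R) -> 'rV[R]_d -> R)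
  (H : (set (Rd R d) -> \bar R) -> 'rV[R]_d -> 'rV[R]_d -> R)
  (L : R) :
  is_lfd F G ->
  (forall x : 'rV[R]_d, is_lfd (fun m => G m x) (fun m => H m x)) ->
  cont2_on_P H ->
  0 < L ->
  (forall (dO : measure_display) (O : measurableType dO) (P : probability O R)
          (eta1 eta2 : O -> 'rV[R]_d),
      measurable_fun setT (eta1 : O -> Rd R d) ->
      measurable_fun setT (eta2 : O -> Rd R d) ->
      (\int[P]_w (sqnorm (eta1 w))%:E < +oo)%E ->
      (\int[P]_w (sqnorm (eta2 w))%:E < +oo)%E ->
      (\int[P]_w ereal_sup [set `|G nu (eta1 w)|%:E | nu in isP2 (d:=d)]
       + \int[P]_w ereal_sup [set `|H nu (eta1 w) (eta2 w)|%:E | nu in isP2 (d:=d)]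
       <= L%:E)%E) ->
  forall mstar : set (Rd R d) -> \bar R,
    isP2 mstar ->
    (F mstar)%:E = ereal_inf [set (F m)%:E | m in isP2 (d:=d)] ->
    forall N : nat, (0 < N)%N ->
      (`| ereal_inf [set (F (empirical x))%:E | x in [set: 'I_N -> 'rV[R]_d]]
          - (F mstar)%:E | <= (2 * L / N%:R)%:E)%E.
Proof.
move=> lfdG lfdH _ L0 bound mstar P2star Fstar N N0.
(* Constant random variables turn the expectation bound into a pointwise one. *)
have H_le nu : isP2 nu -> forall x y, `|H nu x y| <= L.
  move=> P2nu x y.
  pose P : probability (Rd R d) R := @dirac _ (Rd R d) (0 : 'rV[R]_d) R.
  have int_cst c : (\int[P]_w c = c)%E.
    by rewrite -[RHS]mule1 [LHS]integral_cst//; congr (_ * _)%E; exact: probability_setT.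
  have := bound _ _ P (cst x) (cst y).
  rewrite /cst /= !int_cst !ltry => /(_ (measurable_cst _) (measurable_cst _) isT isT).
  rewrite -lee_fin; apply: le_trans; rewrite -[leLHS]add0e; apply: leeD.
    by apply: le_trans (ereal_sup_ubound (ex_intro2 _ _ nu P2nu erefl)); rewrite lee_fin.
  by apply: ereal_sup_ubound; exists nu.
have Nn0 : N%:R != 0 :> R by rewrite pnatr_eq0 -lt0n.
(* With [e = 1 / N] and [k = N] the mass left on [mstar] is zero, and the total cost is
   [N * (2 * L / N ^ 2) = 2 * L / N]. *)
have [||s sN Fs] := @greedy_atoms R d F G H L lfdG lfdH H_le mstar N%:R^-1 P2star _ N.
- by rewrite invr_ge0.
- by rewrite mulVf.
have {}Fs : F (empirical (tnth (Tuple (introT eqP sN)))) <= F mstar + 2 * L / N%:R.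
  rewrite empirical_dirac_sum /=; apply: le_trans (le_trans Fs _); last first.
    by rewrite lerD2l le_eqVlt; apply/orP; left; apply/eqP; field.
  rewrite (_ : comb _ _ _ _ = dirac_sum N%:R^-1 s)//; apply/funext => A.
  by rewrite /comb mulVf// subrr mul0e adde0 mul1e.
set I := ereal_inf _.
(* Empirical measures compete in the infimum over [isP2], so the difference is nonnegative and the
   absolute value disappears. *)
have Fle : ((F mstar)%:E <= I)%E.
  rewrite Fstar; apply: le_ereal_inf_tmp => _ [x _ <-].
  by apply: ereal_inf_lbound; exists (empirical x) => //; exact: isP2_empirical.
have Ile : (I <= (F mstar + 2 * L / N%:R)%:E)%E.
  apply: (@le_trans _ _ (F (empirical (tnth (Tuple (introT eqP sN)))))%:E).
    by apply: ereal_inf_lbound; exists (tnth (Tuple (introT eqP sN))).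
  by rewrite lee_fin.
rewrite gee0_abs ?sube_ge0// lee_subel_addr// addeC -EFinD.
exact: Ile.
Qed.
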